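(* Let $\varepsilon\in(0,1]$ be a real number. Let $A,\Gamma\subset\mathbb{F}_p^*$ be two sufficiently large multiplicative subgroups with $|\Gamma|\le p^{1/2-\varepsilon}$, and let $B\subseteq\mathbb{F}_p$ be an arbitrary nonempty set. Then neither $\Gamma$ nor $\Gamma\sqcup\{0\}$ has a nontrivial representation as $A+B$.
   Context: $p$ is a prime. $A+B=\{a+b:a\in A,b\in B\}$. A representation $S=A+B$ is nontrivial if $|A|\ge2$ and $|B|\ge2$. ''Sufficiently large'' means that $|A|$ and $|\Gamma|$ exceed a suitable constant (which may depend on $\varepsilon$). *)

(* Defs.v *)
From Stdlib Require Import Reals.
From mathcomp Require Import all_boot all_order all_algebra.
Set Implicit Arguments. Unset Strict Implicit. Unset Printing Implicit Defensive.
Import GRing.Theory.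

(* A multiplicative subgroup of F_p^* : a subset of F_p \ {0} containing 1 and
   closed under multiplication (finite, hence closed under inverses). *)
Definition mult_subgroup (p : nat) (A : {set 'F_p}) : bool :=
  [&& (0%R \notin A), (1%R \in A) &
      [forall x in A, forall y in A, (x * y)%R \in A]].

Definition sumset (p : nat) (A B : {set 'F_p}) : {set 'F_p} :=
  [set (a + b)%R | a in A, b in B].

Definition le_pow_half_minus (n p : nat) (eps : R) : Prop :=
  Rle (INR n) (Rpower (INR p) (Rminus (Rinv (IZR 2)) eps)).

(* Main.v *)
Require Import Defs.
From Stdlib Require Import Reals.
From mathcomp Require Import all_boot all_order all_algebra.
From mathcomp Require Import ring zify.

(** Put [n = #|A|], [m = #|G|], [Y = - B], so that the differences [a - y] cover [G] and lie in
    [G] or vanish. The Stepanov-type polynomial of Hanson and Petridis,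
      [f = -1 + n^-1 * \sum_(a in A) a * (a - X) ^ (m + n - 1)],
    has degree [m] and vanishes at each [y] in [Y] to order [n] (order [n - 1] if [y] is in [A]).
    Counting differences shows that these are all its zeros and that the nonzero differences are
    pairwise distinct. Power sums then show that [Y] is invariant under [A], hence is [{0}] together
    with a union of cosets of [A], and that the [n]-th power sum of [Y] is [- (-1)^n * #|Y|].
    Comparing the Taylor coefficients of [f] of orders [n] and [n + 1] at [y] with its factorization
    evaluates [\sum_(z != y) 1 / (y - z)] in closed form. Multiplying by [y * (y^n - 1)] and summing
    over [y] gives a congruence between polynomials in [n] and [#|Y|] of size less than [p], which
    is impossible. *)

Set Implicit Arguments. Unset Strict Implicit. Unset Printing Implicit Defensive.
Import GRing.Theory.
Local Open Scope ring_scope.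

(** * Products of linear factors and Taylor shifts *)

Section LinearFactors.
Variable F : finFieldType.
Implicit Types (f q : {poly F}) (x y c : F) (P : pred F) (e : F -> nat).

Lemma deriv_prod_XsubC_exp P e x : (forall z, P z -> x != z) ->
  (\prod_(z | P z) ('X - z%:P) ^+ e z)^`().[x] =
  (\prod_(z | P z) ('X - z%:P) ^+ e z).[x] * \sum_(z | P z) (e z)%:R / (x - z).
Proof.
move=> xP.
pose K f s := f^`().[x] = f.[x] * s.
apply: (big_rec2 K) => [|z s p Pz]; first by rewrite /K derivC hornerC mulr0.
rewrite /K derivM hornerD !hornerM => ->.
rewrite deriv_exp derivXsubC mul1r hornerMn !horner_exp hornerXsubC.
have nz : x - z != 0 by rewrite subr_eq0 xP.
case: (e z) => [|k] /=; first by rewrite !mulr0n !expr0 !mul0r !add0r mulrA.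
by rewrite -mulr_natr exprS; field.
Qed.

Lemma prod_XsubC_exp_dvdp (s : seq F) e f :
    uniq s -> (forall z, z \in s -> ('X - z%:P) ^+ e z %| f) ->
  \prod_(z <- s) ('X - z%:P) ^+ e z %| f.
Proof.
elim: s => [|z s IHs] /=; first by rewrite big_nil dvd1p.
case/andP=> nsz us dv; rewrite big_cons Gauss_dvdp.
  rewrite dv ?mem_head //= IHs // => j sj; apply: dv.
  by rewrite inE sj orbT.
rewrite big_seq; apply: (big_rec (coprimep (('X - z%:P) ^+ e z))) => [|j p sj co_p].
  exact: coprimep1.
rewrite coprimepMr co_p andbT coprimep_expl // coprimep_expr //.
rewrite coprimep_XsubC root_XsubC.
by apply: contraNneq nsz => <-.
Qed.

(** Substituting ['X - y%:P] back into the shifted polynomial turns its factor ['X^k] into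
    [('X - y%:P) ^+ k]. *)
Lemma dvdp_XsubC_exp f y k :
  (forall i, (i < k)%N -> (f \Po ('X + y%:P))`_i = 0) -> ('X - y%:P) ^+ k %| f.
Proof.
move=> f0; set q := f \Po _ in f0.
have -> : f = q \Po ('X - y%:P).
  by rewrite /q -comp_polyA comp_polyD comp_polyX comp_polyC subrK comp_polyXr.
have -> : q = drop_poly k q * 'X^k.
  rewrite -{1}(poly_take_drop k q) [take_poly k q](_ : _ = 0) ?add0r //.
  by apply/polyP=> i; rewrite coef_take_poly coef0; case: ifP => // /f0.
by rewrite comp_polyM comp_Xn_poly dvdp_mull.
Qed.

Lemma comp_XaddC_coef0 f y : (f \Po ('X + y%:P))`_0 = f.[y].
Proof. by rewrite -horner_coef0 horner_comp !hornerE. Qed.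

Lemma comp_XaddC_coef1 f y : (f \Po ('X + y%:P))`_1 = f^`().[y].
Proof.
have := coef_deriv (f \Po ('X + y%:P)) 0; rewrite mulr1n => <-.
by rewrite deriv_comp derivD derivX derivC addr0 mulr1 comp_XaddC_coef0.
Qed.

Lemma coef_subCX_exp c N k :
  ((c%:P - 'X) ^+ N)`_k = (-1) ^+ k * c ^+ (N - k) *+ 'C(N, k).
Proof.
have -> : (c%:P - 'X) ^+ N =
    \sum_(i < N.+1) ((-1) ^+ i * c ^+ (N - i) *+ 'C(N, i)) *: 'X^i.
  rewrite exprBn; apply: eq_bigr => i _.
  by rewrite -mul_polyC polyCMn polyCM !polyC_exp polyCN mulrnAl.
rewrite coef_sum; case: (leqP k N) => kN; last first.
  rewrite bin_small // mulr0n big1 // => i _; rewrite coefZ coefXn.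
  by rewrite gtn_eqF ?mulr0 // (leq_trans (ltn_ord i)).
have lt_k : (k < N.+1)%N by [].
rewrite (bigD1 (Ordinal lt_k)) //= big1 ?addr0 => [|i ne_ik].
  by rewrite coefZ coefXn eqxx mulr1.
by rewrite coefZ coefXn eq_sym [(_ == k)%N](negbTE ne_ik) mulr0.
Qed.
End LinearFactors.

(** * Power sums over a multiplicative subgroup *)

Section SubgroupSums.
Variables (F : finFieldType) (A : {set F}) (n : nat).
Hypotheses (A0 : 0 \notin A) (A1 : 1 \in A) (AM : {in A &, forall x y, x * y \in A}).
Hypothesis cardA : #|A| = n.

Lemma subgroup_neq0 a : a \in A -> a != 0.
Proof. by move=> aA; apply: contraNneq A0 => <-. Qed.

Lemma subgroup_card_gt0 : (0 < n)%N.
Proof. by rewrite -cardA; apply/card_gt0P; exists 1. Qed.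

Lemma subgroup_mul_imset a : a \in A -> [set a * x | x in A] = A.
Proof.
move=> aA; apply/eqP; rewrite eqEcard card_imset ?leqnn ?andbT; last first.
  exact: mulfI (subgroup_neq0 aA).
by apply/subsetP=> _ /imsetP[x xA ->]; apply: AM.
Qed.

Lemma subgroup_reindex (V : nmodType) (h : F -> V) a : a \in A ->
  \sum_(x in A) h x = \sum_(x in A) h (a * x).
Proof.
move=> aA; rewrite -{1}(subgroup_mul_imset aA) big_imset //=.
by move=> x y _ _; apply: mulfI; apply: subgroup_neq0.
Qed.

Lemma subgroup_expr_card a : a \in A -> a ^+ n = 1.
Proof.
move=> aA; have nz : \prod_(x in A) x != 0.
  by apply/prodf_neq0 => x; apply: subgroup_neq0.
apply: (mulIf nz); rewrite mul1r.
rewrite -{2}(subgroup_mul_imset aA) big_imset //=; last first.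
  by move=> x y _ _; apply: mulfI; apply: subgroup_neq0.
by rewrite big_split /= prodr_const cardA.
Qed.

(** The elements of [A] are already [n] roots of [X^n - 1], which leaves no room for another. *)
Lemma subgroup_expr_eq1 y : (y ^+ n == 1) = (y \in A).
Proof.
apply/eqP/idP => [yn|]; last exact: subgroup_expr_card.
apply/negPn/negP => yA.
have : (size (y :: enum A) < size ('X^n - 1%:P : {poly F})%R)%N.
  apply: max_poly_roots.
  - by rewrite -size_poly_eq0 size_XnsubC ?subgroup_card_gt0.
  - rewrite /= rootE !hornerE yn subrr eqxx /=.
    apply/allP => a; rewrite mem_enum => aA.
    by rewrite rootE !hornerE subgroup_expr_card // subrr.
  - by rewrite /= mem_enum yA enum_uniq.
by rewrite size_XnsubC ?subgroup_card_gt0 //= -cardE cardA ltnn.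
Qed.

(** Otherwise, with [j = k %% n], the nonzero polynomial [X^j - 1] of degree below [n] would vanish
    on all of [A]. *)
Lemma subgroup_ex_expr_neq1 k : ~~ (n %| k)%N -> exists2 a, a \in A & a ^+ k != 1.
Proof.
move=> nk; apply/exists_inP; apply: contraNT nk.
rewrite negb_exists => /forallP all1.
pose j := (k %% n)%N.
have [j0|j_gt0] := posnP j; first by rewrite /dvdn -/j j0.
have ajk a : a \in A -> a ^+ j = 1.
  move=> aA; have := all1 a; rewrite aA /= negbK => /eqP.
  by rewrite {1}(divn_eq k n) exprD mulnC exprM subgroup_expr_card // expr1n mul1r.
have : (size (enum A) < size ('X^j - 1%:P : {poly F})%R)%N.
  apply: max_poly_roots; rewrite ?enum_uniq //.
  - by rewrite -size_poly_eq0 size_XnsubC.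
  - apply/allP => a; rewrite mem_enum => aA.
    by rewrite rootE !hornerE ajk // subrr.
by rewrite size_XnsubC // -cardE cardA ltnS leqNgt ltn_mod subgroup_card_gt0.
Qed.

(** Multiplication by [a] permutes [A], so the sum is fixed by the factor [a ^+ k], which can be
    chosen different from 1 unless [n] divides [k]. *)
Lemma subgroup_power_sum k : \sum_(a in A) a ^+ k = if (n %| k)%N then n%:R else 0.
Proof.
case: ifPn => [/dvdnP[q ->]|nk].
  rewrite -cardA -sumr_const cardA; apply: eq_bigr => a aA.
  by rewrite mulnC exprM subgroup_expr_card // expr1n.
have [a aA ak] := subgroup_ex_expr_neq1 nk.
apply/eqP; move: ak; rewrite -subr_eq0 => /mulfI inj; apply/eqP; apply: inj.
rewrite mulr0 mulrBl mul1r {2}(subgroup_reindex _ aA) mulr_sumr -sumrB big1 //.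
by move=> x _; rewrite exprMn subrr.
Qed.

(** * Partial fraction sums over the subgroup *)

Section PartialFractions.
Variable y : F.
Hypothesis yA : y \notin A.

Lemma subgroup_expr_sub1_neq0 : y ^+ n - 1 != 0.
Proof. by rewrite subr_eq0 subgroup_expr_eq1. Qed.

Lemma subgroup_sub_neq0 a : a \in A -> y - a != 0.
Proof. by move=> aA; rewrite subr_eq0; apply: contraNneq yA => ->. Qed.

(** Since [a ^+ n = 1], this is the factorization of [y ^+ n - a ^+ n]. It reduces sums of inverses
    to power sums of [A]. *)
Lemma subgroup_inv_sub a : a \in A ->
  (y - a)^-1 = (\sum_(i < n) y ^+ (n.-1 - i) * a ^+ i) / (y ^+ n - 1).
Proof.
move=> aA; apply: (mulfI (subgroup_sub_neq0 aA)).
rewrite divff ?subgroup_sub_neq0 // mulrA -[in RHS](subgroup_expr_card aA).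
rewrite [y ^+ n - _]subrXX.
have nz : (y - a) * (\sum_(i < n) y ^+ (n.-1 - i) * a ^+ i) != 0.
  by rewrite -subrXX (subgroup_expr_card aA) subgroup_expr_sub1_neq0.
by rewrite divff.
Qed.

Lemma sum_inv_sub_subgroup :
  \sum_(a in A) (y - a)^-1 = n%:R * y ^+ n.-1 / (y ^+ n - 1).
Proof.
rewrite (eq_bigr _ subgroup_inv_sub) -mulr_suml exchange_big /=; congr (_ / _).
have n_gt0 := subgroup_card_gt0.
rewrite (bigD1 (Ordinal n_gt0)) //= [X in _ + X]big1 ?addr0 => [|i ne_i0].
  by rewrite -mulr_sumr subgroup_power_sum /= dvdn0 subn0 mulrC.
have i_gt0 : (0 < i)%N by rewrite lt0n.
by rewrite -mulr_sumr subgroup_power_sum gtnNdvd // mulr0.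
Qed.

Lemma sum_div_sub_subgroup :
  \sum_(a in A) a / (y - a) = n%:R / (y ^+ n - 1).
Proof.
have split_a a : a \in A -> a / (y - a) = y / (y - a) - 1.
  by move=> aA; have nz := subgroup_sub_neq0 aA; field.
rewrite (eq_bigr _ split_a) sumrB -mulr_sumr sum_inv_sub_subgroup sumr_const cardA.
have := subgroup_expr_sub1_neq0; rewrite -(prednK subgroup_card_gt0) exprS => nz.
by field.
Qed.

Lemma sum_div_sub_sqr_subgroup :
  \sum_(a in A) a / (y - a) ^+ 2 = n%:R ^+ 2 * y ^+ n.-1 / (y ^+ n - 1) ^+ 2.
Proof.
pose c := (y ^+ n - 1) ^- 2.
have expand a : a \in A -> a / (y - a) ^+ 2 =
    c * \sum_(i < n) \sum_(j < n) y ^+ (n.-1 - i) * y ^+ (n.-1 - j) * a ^+ (i + j).+1.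
  move=> aA; rewrite -exprVn subgroup_inv_sub // exprMn exprVn -/c mulrA mulrC; congr (_ * _).
  rewrite expr2 mulr_suml mulr_sumr; apply: eq_bigr => i _.
  rewrite mulr_sumr mulr_sumr; apply: eq_bigr => j _.
  by rewrite exprS exprD; ring.
rewrite (eq_bigr _ expand) -mulr_sumr exchange_big /= mulrC; congr (_ * _).
(* As [0 < i + j + 1 < 2 n], the power sum survives only for [i + j + 1 = n], that is for
   [j = rev_ord i]. *)
have inner (i : 'I_n) : \sum_(a in A) \sum_(j < n)
    y ^+ (n.-1 - i) * y ^+ (n.-1 - j) * a ^+ (i + j).+1 = n%:R * y ^+ n.-1.
  rewrite exchange_big /= (bigD1 (rev_ord i)) //= [X in _ + X]big1 ?addr0 => [|j ne_j].
    have ltin := ltn_ord i.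
    rewrite -mulr_sumr subgroup_power_sum.
    have -> : (i + (n - i.+1)).+1 = n by lia.
    rewrite dvdnn mulrC -exprD; congr (_ * _ ^+ _); lia.
  rewrite -mulr_sumr subgroup_power_sum ifN ?mulr0 //.
  apply: contraNN ne_j => /dvdnP[q Eq]; apply/eqP/val_inj => /=.
  have ltin := ltn_ord i; have ltjn := ltn_ord j.
  by case: q Eq => [|[|q]]; [lia | lia | nia].
rewrite (eq_bigr _ (fun i _ => inner i)) sumr_const card_ord.
by rewrite -[LHS]mulr_natl expr2 mulrA.
Qed.

End PartialFractions.
End SubgroupSums.

(** * The Stepanov polynomial and its zeros *)

Section Stepanov.
Variables (F : finFieldType) (p : nat) (A Y : {set F}) (n m : nat).
Hypothesis natF_neq0 : forall k, (0 < k < p)%N -> k%:R != 0 :> F.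
Hypotheses (A0 : 0 \notin A) (A1 : 1 \in A) (AM : {in A &, forall x y, x * y \in A}).
Hypotheses (cardA : #|A| = n) (n_gt1 : (1 < n)%N) (m_gt1 : (1 < m)%N).
Hypothesis N_ltp : (m + n.-1 < p)%N.
Hypothesis AY : forall a y, a \in A -> y \in Y -> a != y -> (a - y) ^+ m = 1.

Local Notation N := (m + n.-1)%N.

Definition stepanov_poly : {poly F} :=
  n%:R^-1 *: (\sum_(a in A) a *: (a%:P - 'X) ^+ N) - 1.
Local Notation f := stepanov_poly.

Lemma bin_neq0 k : (k <= N)%N -> 'C(N, k)%:R != 0 :> F.
Proof.
move=> kN; have fact_neq0 j : (j <= N)%N -> j`!%:R != 0 :> F.
  elim: j => [|j IHj] jN; first by rewrite fact0 oner_eq0.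
  by rewrite factS natrM mulf_neq0 ?IHj ?natF_neq0 ?(ltnW jN) //= (leq_ltn_trans jN).
have := fact_neq0 N (leqnn N); rewrite -(bin_fact kN) natrM mulf_eq0 negb_or.
by case/andP.
Qed.

Lemma cardA_neq0 : n%:R != 0 :> F.
Proof. by apply: natF_neq0; lia. Qed.

Lemma stepanov_coef k : f`_k =
  n%:R^-1 * (\sum_(a in A) a ^+ (N - k).+1) * (-1) ^+ k * 'C(N, k)%:R - (k == 0)%N%:R.
Proof.
rewrite coefB coefZ coef1 coef_sum -!mulrA; congr (_ * _ - _).
rewrite mulr_suml; apply: eq_bigr => a _.
by rewrite coefZ coef_subCX_exp exprS -mulr_natr; ring.
Qed.

(** For [m < k <= N] the exponent [(N - k).+1] lies strictly between 0 and [n], so the power sum of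
    [A] vanishes: the degree drops from [N] to [m]. *)
Lemma stepanov_coef_gt k : (m < k)%N -> f`_k = 0.
Proof.
move=> mk; have k_neq0 : (k == 0)%N = false by apply/eqP; lia.
rewrite stepanov_coef k_neq0 subr0; have [kN|Nk] := leqP k N.
  rewrite (subgroup_power_sum A0 A1 AM cardA) gtnNdvd ?mulr0 ?mul0r //.
  by apply/ltP; lia.
by rewrite bin_small // mulr0.
Qed.

Lemma stepanov_lead : f`_m != 0.
Proof.
have m_neq0 : (m == 0)%N = false by apply/eqP; lia.
rewrite stepanov_coef m_neq0 subr0 (subgroup_power_sum A0 A1 AM cardA) addKn.
rewrite prednK ?dvdnn ?(ltnW n_gt1) // mulVf ?cardA_neq0 // mul1r.
by rewrite mulf_neq0 ?expf_neq0 ?oppr_eq0 ?oner_eq0 // bin_neq0 ?leq_addr.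
Qed.

Lemma stepanov_neq0 : f != 0.
Proof. by apply: contraNneq stepanov_lead => ->; rewrite coef0. Qed.

Lemma stepanov_size : (size f <= m.+1)%N.
Proof. by apply/leq_sizeP => k; apply: stepanov_coef_gt. Qed.

(** After expansion the exponents of [a] lie between 1 and [j.+1 <= n]; the value [n] occurs only
    for [i = 0] and [j = n.-1]. *)
Lemma shifted_moment y j : (j < n)%N ->
  \sum_(a in A) a * (a - y) ^+ j = if (j == n.-1)%N then n%:R else 0.
Proof.
move=> ltjn.
have expand a : a \in A -> a * (a - y) ^+ j =
    \sum_(i < j.+1) ((-1) ^+ i * y ^+ i *+ 'C(j, i)) * a ^+ (j - i).+1.
  move=> _; rewrite exprBn mulr_sumr; apply: eq_bigr => i _.
  by rewrite exprS -[in LHS]mulr_natr -[in RHS]mulr_natr; ring.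
rewrite (eq_bigr _ expand) exchange_big /= big_ord_recl [X in _ + X]big1 ?addr0 => [|i _].
  rewrite -mulr_sumr (subgroup_power_sum A0 A1 AM cardA) subn0 bin0 !expr0 mulr1 mulr1n mul1r.
  have [->|ne_j] := eqVneq j n.-1; first by rewrite prednK ?dvdnn // ltnW.
  by rewrite gtnNdvd //; lia.
rewrite -mulr_sumr (subgroup_power_sum A0 A1 AM cardA) gtnNdvd ?mulr0 //.
by rewrite lift0; lia.
Qed.

Lemma stepanov_taylor y k : (f \Po ('X + y%:P))`_k =
  n%:R^-1 * (\sum_(a in A) a * (a - y) ^+ (N - k)) * (-1) ^+ k * 'C(N, k)%:R
    - (k == 0)%N%:R.
Proof.
rewrite /stepanov_poly -polyC1 comp_polyB comp_polyZ comp_polyC coefB coefZ coefC.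
rewrite raddf_sum /= coef_sum -!mulrA; congr (_ * _ - _); last by case: (k == 0)%N.
rewrite mulr_suml; apply: eq_bigr => a _.
rewrite comp_polyZ rmorphXn /= comp_polyB comp_polyX comp_polyC.
have -> : a%:P - ('X + y%:P) = (a - y)%:P - 'X by rewrite polyCB; ring.
by rewrite coefZ coef_subCX_exp -mulr_natr; ring.
Qed.

(** The factor [(a - y) ^+ m = 1] drops out, leaving a shifted moment of order [n.-1 - k]. It
    vanishes for [k > 0], and for [k = 0] it cancels the constant [-1]. *)
Lemma stepanov_taylor_eq0 y k : y \in Y -> (k < n - (y \in A))%N ->
  (f \Po ('X + y%:P))`_k = 0.
Proof.
move=> yY kn; rewrite stepanov_taylor.
have -> : \sum_(a in A) a * (a - y) ^+ (N - k) =
          \sum_(a in A) a * (a - y) ^+ (n.-1 - k).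
  apply: eq_bigr => a aA; congr (_ * _).
  have -> : (N - k = m + (n.-1 - k))%N by lia.
  have [eq_ay|ne_ay] := eqVneq a y; last by rewrite exprD AY // mul1r.
  (* The term [a = y] is 0 on both sides: here [y] is in [A], so [k < n.-1] and the exponent
     [n.-1 - k] is positive. *)
  rewrite eq_ay subrr expr0n.
  by move: kn; rewrite -eq_ay aA /= => kn; rewrite !expr0n; congr (_%:R); lia.
rewrite shifted_moment; last lia.
case: k kn => [|k] kn.
  by rewrite subn0 eqxx mulVf ?cardA_neq0 // expr0 bin0 !mulr1 subrr.
by rewrite ifN ?mulr0 ?mul0r ?subrr //; lia.
Qed.

Lemma stepanov_dvdp : \prod_(y in Y) ('X - y%:P) ^+ (n - (y \in A)) %| f.
Proof.
rewrite -big_enum; apply: prod_XsubC_exp_dvdp; rewrite ?enum_uniq //= => y.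
rewrite mem_enum => yY; apply: dvdp_XsubC_exp => k.
exact: stepanov_taylor_eq0.
Qed.

Lemma sum_multiplicities :
  (\sum_(y in Y) (n - (y \in A)) = n * #|Y| - #|Y :&: A|)%N.
Proof.
have -> : #|Y :&: A| = (\sum_(y in Y) (y \in A))%N.
  rewrite -sum1_card (eq_bigl (fun y => (y \in Y) && (y \in A))) => [|y]; last exact: in_setI.
  by rewrite big_mkcondr; apply: eq_bigr => y _; case: (y \in A).
have -> : (n * #|Y| = \sum_(y in Y) n)%N by rewrite sum_nat_const mulnC.
by rewrite sumnB // => y _; case: (y \in A); rewrite // ltnW.
Qed.

Lemma size_prod_multiplicities :
  size (\prod_(y in Y) ('X - y%:P) ^+ (n - (y \in A)) : {poly F})%R =
  (n * #|Y| - #|Y :&: A|).+1.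
Proof.
rewrite -sum_multiplicities.
pose K (q : {poly F}) s := (q \is monic) && (size q == s.+1).
suff /andP[_ /eqP] : K (\prod_(y in Y) ('X - y%:P) ^+ (n - (y \in A)))%R
                       (\sum_(y in Y) (n - (y \in A)))%N by [].
apply: (big_rec2 K) => [|y s q _ /andP[mon_q /eqP sz_q]].
  by rewrite /K monic1 size_poly1.
have mon_y := monic_exp (n - (y \in A)) (monicXsubC y).
by rewrite /K monicMl // mon_q size_Mmonic ?monic_neq0 // size_exp_XsubC sz_q addnS /=.
Qed.

Lemma card_le_stepanov : (n * #|Y| - #|Y :&: A| <= m)%N.
Proof.
have := leq_trans (dvdp_leq stepanov_neq0 stepanov_dvdp) stepanov_size.
by rewrite size_prod_multiplicities ltnS.
Qed.

(** * The case of equality in the degree bound *)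

Section Extremal.
Hypothesis cardY : (n * #|Y| - #|Y :&: A| = m)%N.

Lemma stepanov_factor :
  exists2 c, c != 0 & f = c *: \prod_(y in Y) ('X - y%:P) ^+ (n - (y \in A)).
Proof.
have : \prod_(y in Y) ('X - y%:P) ^+ (n - (y \in A)) %= f.
  rewrite -(dvdp_size_eqp stepanov_dvdp) eqn_leq dvdp_leq ?stepanov_neq0 ?stepanov_dvdp //=.
  by rewrite size_prod_multiplicities cardY stepanov_size.
case/eqpP => [[c1 c2]] /= /andP[c1_neq0 c2_neq0] eq_c.
exists (c1 / c2); first by rewrite mulf_neq0 ?invr_eq0.
by rewrite mulrC -scalerA eq_c scalerA mulVf // scale1r.
Qed.

Lemma stepanov_root y : root f y -> y \in Y.
Proof.
have [c c_neq0 ->] := stepanov_factor; rewrite rootZ // => yf.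
apply: contraTT yf => nYy; rewrite rootE horner_prod.
apply/prodf_neq0 => z zY; rewrite horner_exp hornerXsubC expf_neq0 // subr_eq0.
by apply: contraNneq nYy => ->.
Qed.

(** The constant coefficient of [f] involves the power sum of exponent [m + n], a multiple of [n],
    whose contribution 1 cancels the [-1]. *)
Lemma stepanov_root0 : (n %| m)%N -> 0 \in Y.
Proof.
move=> n_m; apply: stepanov_root; rewrite rootE horner_coef0 stepanov_coef.
rewrite subn0 -addnS prednK ?(ltnW n_gt1) // (subgroup_power_sum A0 A1 AM cardA).
by rewrite dvdn_addr // dvdnn bin0 expr0 !mulr1 mulVf ?cardA_neq0 // subrr.
Qed.

(** Dividing [f] by [('X - y%:P) ^+ n] leaves [q], whose value and derivative at [y] are the Taylor
    coefficients of [f] of orders [n] and [n.+1]. Their quotient is the logarithmic derivative of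
    the remaining product. *)
Lemma stepanov_log_derivative y : y \in Y -> y \notin A ->
  n.+1%:R * (y ^+ n - 1) *
    \sum_(z in Y | z != y) (n - (z \in A))%:R / (y - z) =
  n%:R * m.-1%:R * y ^+ n.-1.
Proof.
move=> yY yA; have [c c_neq0 def_f] := stepanov_factor.
pose q := c *: \prod_(z in Y | z != y) ('X - z%:P) ^+ (n - (z \in A)).
have {}def_f : f \Po ('X + y%:P) = (q \Po ('X + y%:P)) * 'X^n.
  rewrite def_f (bigD1 y) //= (negbTE yA) subn0 mulrC scalerAl -/q.
  by rewrite comp_polyM rmorphXn /= comp_polyB comp_polyX comp_polyC addrK.
have dq : q^`().[y] = q.[y] * \sum_(z in Y | z != y) (n - (z \in A))%:R / (y - z).
  rewrite /q derivZ !hornerZ deriv_prod_XsubC_exp ?mulrA // => z /andP[_].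
  by rewrite eq_sym.
have D_neq0 := subgroup_expr_sub1_neq0 A0 A1 AM cardA yA.
have inv_sub a : a \in A -> (a - y) ^+ m = 1 /\ a - y != 0.
  move=> aA; have ne_ay : a != y by apply: contraNneq yA => <-.
  by rewrite AY // subr_eq0.
have coefn : q.[y] = - (-1) ^+ n * 'C(N, n)%:R / (y ^+ n - 1).
  have <- : (f \Po ('X + y%:P))`_n = q.[y].
    by rewrite def_f coefMXn ltnn subnn comp_XaddC_coef0.
  rewrite stepanov_taylor gtn_eqF ?(ltnW n_gt1) // subr0.
  (* Here [N - n = m.-1], so the power is the inverse of [a - y] and the sum is a partial fraction
     sum. Order [n.+1] likewise gives the inverse square. *)
  have -> : \sum_(a in A) a * (a - y) ^+ (N - n) = - (n%:R / (y ^+ n - 1)).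
    rewrite -(sum_div_sub_subgroup A0 A1 AM cardA yA) -sumrN.
    apply: eq_bigr => a aA; have [am nz] := inv_sub a aA.
    have nz' : y - a != 0 by rewrite -opprB oppr_eq0.
    have -> : (N - n = m.-1)%N by lia.
    apply: (mulIf nz); rewrite -mulrA -exprSr prednK ?am ?(ltnW m_gt1) //.
    by field.
  by have := cardA_neq0 => nz; field; apply/andP.
have coefnS : q^`().[y] =
    - (-1) ^+ n * 'C(N, n.+1)%:R * (n%:R * y ^+ n.-1) / (y ^+ n - 1) ^+ 2.
  have <- : (f \Po ('X + y%:P))`_n.+1 = q^`().[y].
    by rewrite def_f coefMXn ltnNge leqnSn /= subSnn comp_XaddC_coef1.
  rewrite stepanov_taylor subr0.
  have -> : \sum_(a in A) a * (a - y) ^+ (N - n.+1) =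
      n%:R ^+ 2 * y ^+ n.-1 / (y ^+ n - 1) ^+ 2.
    rewrite -(sum_div_sub_sqr_subgroup A0 A1 AM cardA yA).
    apply: eq_bigr => a aA; have [am nz] := inv_sub a aA.
    have nz' : y - a != 0 by rewrite -opprB oppr_eq0.
    have -> : (N - n.+1 = m.-2)%N by lia.
    apply: (mulIf (expf_neq0 2 nz)); rewrite -mulrA -exprD addn2.
    have -> : m.-2.+2 = m by lia.
    by rewrite am; field.
  by have := cardA_neq0 => nz; rewrite [(-1) ^+ n.+1]exprS; field; apply/andP.
have binS : 'C(N, n.+1)%:R * n.+1%:R = 'C(N, n)%:R * m.-1%:R :> F.
  rewrite -!natrM mulnC [in RHS]mulnC; congr (_%:R).
  by rewrite mul_bin_left; congr (_ * _)%N; lia.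
have bin_nz : 'C(N, n)%:R != 0 :> F by apply: bin_neq0; lia.
have sign_nz : - (-1) ^+ n != 0 :> F by rewrite oppr_eq0 expf_neq0 ?oppr_eq0 ?oner_eq0.
move: dq; rewrite coefn coefnS => dq.
set L := \sum_(z in Y | z != y) _ in dq *.
have {}dq : 'C(N, n.+1)%:R * (n%:R * y ^+ n.-1) = 'C(N, n)%:R * (y ^+ n - 1) * L.
  apply: (mulfI sign_nz); apply: (mulIf (invr_neq0 (expf_neq0 2 D_neq0))).
  by rewrite !mulrA in dq *; rewrite dq; field.
apply: (mulfI bin_nz).
transitivity (n.+1%:R * ('C(N, n)%:R * (y ^+ n - 1) * L)); first by ring.
rewrite -dq; transitivity ('C(N, n.+1)%:R * n.+1%:R * (n%:R * y ^+ n.-1)); first by ring.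
by rewrite binS; ring.
Qed.

End Extremal.
End Stepanov.

(** * Invariant sets and divided differences *)

Section CosetUnion.
Variables (F : finFieldType) (A : {set F}) (n : nat).
Hypotheses (A0 : 0 \notin A) (A1 : 1 \in A) (AM : {in A &, forall x y, x * y \in A}).
Hypothesis cardA : #|A| = n.

(** The fibres of [z ^+ n] on [Z] are cosets of [A], each with [n] elements. *)
Lemma dvdn_card_invariant (Z : {set F}) :
  0 \notin Z -> (forall a z, a \in A -> z \in Z -> a * z \in Z) -> (n %| #|Z|)%N.
Proof.
move=> Z0 AZ; rewrite -sum1_card (partition_big_imset (fun z => z ^+ n)) /=.
apply: dvdn_sum => w /imsetP[z zZ ->]; rewrite sum1_card.
have z_neq0 : z != 0 by apply: contraNneq Z0 => <-.
suff -> : #|[pred x in Z | x ^+ n == z ^+ n]| = #|[set a * z | a in A]|.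
  by rewrite card_imset ?cardA //; apply: mulIf.
apply: eq_card => x; rewrite inE /=; apply/andP/imsetP => [[xZ /eqP eq_xz]|[a aA ->]].
  exists (x / z); last by rewrite divfK.
  by rewrite -(subgroup_expr_eq1 A0 A1 AM cardA) expr_div_n eq_xz divff ?expf_neq0.
by rewrite AZ // exprMn (subgroup_expr_card A0 AM cardA aA) mul1r.
Qed.

End CosetUnion.

(* Symmetrizing the double sum turns each [1 / (y - z)] into a divided difference of [h]. *)
Lemma sum_antisym_inv (F : finFieldType) (Z : {set F}) (h : F -> F) :
  (\sum_(y in Z) h y * \sum_(z in Z | z != y) (y - z)^-1) *+ 2 =
  \sum_(y in Z) \sum_(z in Z | z != y) (h y - h z) / (y - z).
Proof.
rewrite mulr2n (eq_bigr (fun y => \sum_(z in Z | z != y) h y / (y - z))) => [|y _]; last first.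
  by rewrite mulr_sumr.
rewrite {2}(exchange_big_dep (mem Z)) /= => [|y z _ /andP[] //].
rewrite -big_split /=; apply: eq_bigr => y yZ.
rewrite [X in _ + X](eq_bigl (fun z => (z \in Z) && (z != y))) => [|z]; last first.
  by rewrite yZ eq_sym.
rewrite -big_split /=; apply: eq_bigr => z /andP[_ ne_zy].
by rewrite mulrBl -(opprB y z) invrN mulrN.
Qed.

(** The divided difference is the polynomial [H]; its diagonal value is added and subtracted. In the
    full double sum only the monomials [y ^+ n] and [z ^+ n] and the constant survive. *)
Lemma sum_divided_difference (F : finFieldType) (Z : {set F}) (n : nat) : (0 < n)%N ->
    (forall k, (0 < k < n)%N -> \sum_(z in Z) z ^+ k = 0) ->
  \sum_(y in Z) \sum_(z in Z | z != y) (y * (y ^+ n - 1) - z * (z ^+ n - 1)) / (y - z) =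
  (#|Z|%:R *+ 2 - n.+1%:R) * (\sum_(z in Z) z ^+ n) - #|Z|%:R ^+ 2 + #|Z|%:R.
Proof.
move=> n_gt0 P0; set P := \sum_(z in Z) z ^+ n.
pose H (y z : F) := (\sum_(i < n.+1) y ^+ (n - i) * z ^+ i) - 1.
have diff y : y \in Z ->
    \sum_(z in Z | z != y) (y * (y ^+ n - 1) - z * (z ^+ n - 1)) / (y - z) =
    \sum_(z in Z) H y z - (n.+1%:R * y ^+ n - 1).
  move=> yZ; rewrite [in RHS](bigD1 y) //= [in RHS]addrC.
  have -> : H y y = n.+1%:R * y ^+ n - 1.
    rewrite /H; congr (_ - _); rewrite (eq_bigr (fun=> y ^+ n)) => [|i _].
      by rewrite sumr_const card_ord mulr_natl.
    by rewrite -exprD subnK // -ltnS.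
  rewrite addrK; apply: eq_bigr => z /andP[_ ne_zy].
  have nz : y - z != 0 by rewrite subr_eq0 eq_sym.
  apply: (mulIf nz); rewrite divfK // /H mulrBl mul1r [in RHS]mulrC -subrXX !exprS; ring.
rewrite (eq_bigr _ diff) sumrB sumrB -mulr_sumr -/P sumr_const.
have -> : \sum_(y in Z) \sum_(z in Z) H y z = #|Z|%:R *+ 2 * P - #|Z|%:R ^+ 2.
  transitivity (\sum_(i < n.+1) (\sum_(y in Z) y ^+ (n - i)) * (\sum_(z in Z) z ^+ i)
      - #|Z|%:R ^+ 2).
    have expand y : y \in Z -> \sum_(z in Z) H y z =
        \sum_(i < n.+1) y ^+ (n - i) * (\sum_(z in Z) z ^+ i) - #|Z|%:R.
      move=> _; rewrite sumrB exchange_big sumr_const /=; congr (_ - _).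
      by apply: eq_bigr => i _; rewrite mulr_sumr.
    rewrite (eq_bigr _ expand) sumrB sumr_const exchange_big /=; congr (_ - _).
      by apply: eq_bigr => i _; rewrite mulr_suml.
    by rewrite expr2 mulr_natr.
  congr (_ - _); rewrite (bigD1 ord0) //= (bigD1 ord_max) -?val_eqE /= -?lt0n //.
  rewrite [X in _ + (_ + X)]big1 => [|i /andP[i_neq0 i_neqn]]; last first.
    rewrite [X in _ * X]P0 ?mulr0 //; move: i_neq0 i_neqn (ltn_ord i).
    by rewrite -!val_eqE /=; lia.
  have P_0 : \sum_(z in Z) z ^+ 0 = #|Z|%:R by rewrite sumr_const.
  by rewrite subn0 subnn P_0 -/P; ring.
ring.
Qed.

(** This bound and the next serve the case [A \subset Y], where [m = n * (R + n - 1)]: they keep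
    both sides of the final congruence below [m ^ 2 <= p]. *)
Lemma quadratic_lt_sqr_l (n R : nat) : (3 < n)%N -> (0 < R)%N ->
  ((n + 3) * R ^ 2 + 3 * n * R < (n * (R + n - 1)) ^ 2)%N.
Proof.
move=> n_gt3; case: R => // k _; have -> : (k.+1 + n - 1 = k + n)%N by lia.
have n2 : (n + 3 <= n * n)%N by nia.
have n3 : (5 * n + 6 <= 2 * (n * n * n))%N by nia.
have n4 : (4 * n + 3 < n * n * (n * n))%N by nia.
have := leq_mul n2 (leqnn (k * k)); have := leq_mul n3 (leqnn k).
rewrite !expnS !expn0 !muln1; lia.
Qed.

Lemma quadratic_lt_sqr_r (n R : nat) : (3 < n)%N -> (0 < R)%N ->
  ((n ^ 2 + 2) * R + 2 * n ^ 3 + 2 * n < (n * (R + n - 1)) ^ 2)%N.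
Proof.
move=> n_gt3; case: R => // k _; have -> : (k.+1 + n - 1 = k + n)%N by lia.
have n3 : (n * n + 2 <= 2 * (n * n * n))%N by nia.
have n4 : (n * n + 2 * (n * n * n) + 2 * n + 2 < n * n * (n * n))%N by nia.
have := leq_mul n3 (leqnn k).
rewrite !expnS !expn0 !muln1; nia.
Qed.

(** * Differences covering the subgroup [G] *)

Section Decomposition.
Variables (F : finFieldType) (p : nat) (A G Y : {set F}) (n m : nat).
Hypothesis natF_neq0 : forall k, (0 < k < p)%N -> k%:R != 0 :> F.
Hypotheses (A0 : 0 \notin A) (A1 : 1 \in A) (AM : {in A &, forall x y, x * y \in A}).
Hypotheses (G0 : 0 \notin G) (G1 : 1 \in G) (GM : {in G &, forall x y, x * y \in G}).
Hypotheses (cardA : #|A| = n) (n_gt3 : (3 < n)%N) (cardG : #|G| = m) (m_gt1 : (1 < m)%N).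
Hypotheses (N_ltp : (m + n.-1 < p)%N) (Y_gt1 : (1 < #|Y|)%N).
Hypothesis sub_G : forall a y, a \in A -> y \in Y -> a != y -> a - y \in G.
Hypothesis G_sub : forall g, g \in G -> exists a y, [/\ a \in A, y \in Y & g = a - y].

Let n_gt1 : (1 < n)%N. Proof. exact: leq_trans n_gt3. Qed.

Let n_neq0 : n%:R != 0 :> F.
Proof. by apply: natF_neq0; lia. Qed.

Let AY a y : a \in A -> y \in Y -> a != y -> (a - y) ^+ m = 1.
Proof. by move=> aA yY ay; apply: (subgroup_expr_card G0 GM cardG); apply: sub_G. Qed.

Let pairs := [set u in setX A Y | u.1 != u.2].

Lemma big_pairs (V : nmodType) (h : F -> F -> V) :
  \sum_(u in pairs) h u.1 u.2 = \sum_(y in Y) \sum_(a in A | a != y) h a y.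
Proof.
rewrite (exchange_big_dep (mem A)) /= => [|y a _ /andP[] //].
rewrite pair_big_dep /=; apply: eq_bigl => -[a y].
by rewrite !inE /=; case: (a \in A).
Qed.

Lemma card_pairs : #|pairs| = (n * #|Y| - #|Y :&: A|)%N.
Proof.
rewrite -(sum_multiplicities A Y n_gt1) -sum1_card (big_pairs (fun _ _ => 1%N)).
apply: eq_bigr => y _; rewrite sum1_card -cardA.
rewrite (cardsD1 y A) addKn; apply: eq_card => a.
by rewrite !inE andbC.
Qed.

Lemma sub_pairs : [set u.1 - u.2 | u in pairs] = G.
Proof.
apply/eqP; rewrite eqEsubset; apply/andP; split; apply/subsetP => g.
  by case/imsetP=> -[a y]; rewrite !inE /= => /andP[/andP[aA yY] ay] ->; apply: sub_G.
move=> gG; have [a [y [aA yY def_g]]] := G_sub gG.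
apply/imsetP; exists (a, y); rewrite // !inE /= aA yY /=.
by apply: contraNneq G0 => eq_ay; rewrite -[0](subrr y) -{1}eq_ay -def_g.
Qed.

(** The Stepanov degree bound gives one inequality; the other holds because the pairs map onto
    [G]. *)
Lemma card_decomposition : (n * #|Y| - #|Y :&: A| = m)%N.
Proof.
apply/eqP; rewrite eqn_leq (card_le_stepanov natF_neq0) //=.
by rewrite -card_pairs -cardG -sub_pairs leq_imset_card.
Qed.

Lemma sub_pairs_inj : {in pairs &, injective (fun u => u.1 - u.2)}.
Proof. by apply/imset_injP; rewrite sub_pairs cardG card_pairs card_decomposition. Qed.

(** The nonzero differences run once through [G], so this is a power sum of [G]; the terms [a = y]
    add nothing since [k > 0]. *)
Lemma sum_sub_exp k : (0 < k < m)%N -> \sum_(y in Y) \sum_(a in A) (a - y) ^+ k = 0.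
Proof.
case/andP=> k_gt0 km.
transitivity (\sum_(g in G) g ^+ k); last first.
  by rewrite (subgroup_power_sum G0 G1 GM cardG) gtnNdvd.
rewrite -sub_pairs (big_imset _ sub_pairs_inj) /=.
rewrite (big_pairs (fun a y => (a - y) ^+ k)); apply: eq_bigr => y _.
rewrite [LHS](bigID (fun a => a == y)) /= [X in X + _]big1 ?add0r // => a /andP[_ /eqP->].
by rewrite subrr expr0n; case: k k_gt0 {km}.
Qed.

(** * Power sums of [Y] and its invariance under [A] *)

Definition power_sum k := \sum_(y in Y) y ^+ k.

Lemma sum_sub_exp_expand k : \sum_(y in Y) \sum_(a in A) (a - y) ^+ k =
  \sum_(i < k.+1) (-1) ^+ i * 'C(k, i)%:R * (if (n %| k - i)%N then n%:R else 0) * power_sum i.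
Proof.
have expand y : y \in Y -> \sum_(a in A) (a - y) ^+ k = \sum_(i < k.+1)
    (-1) ^+ i * 'C(k, i)%:R * (if (n %| k - i)%N then n%:R else 0) * y ^+ i.
  move=> _; rewrite (eq_bigr _ (fun a _ => exprBn a y k)) exchange_big /=.
  apply: eq_bigr => i _; rewrite -(subgroup_power_sum A0 A1 AM cardA).
  rewrite mulr_sumr mulr_suml; apply: eq_bigr => a _.
  by rewrite -mulr_natr; ring.
rewrite (eq_bigr _ expand) exchange_big /=; apply: eq_bigr => i _.
by rewrite -mulr_sumr.
Qed.

(** Strong induction: in the expansion of order [k], a term [i < k] with [n] dividing [k - i] has
    [i] not divisible by [n], so only [i = k] is left. *)
Lemma power_sum_eq0 k : (k < m)%N -> ~~ (n %| k)%N -> power_sum k = 0.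
Proof.
elim/ltn_ind: k => k IHk km nk.
have k_gt0 : (0 < k)%N by case: k nk {IHk km}; rewrite ?dvdn0.
have := sum_sub_exp_expand k; rewrite sum_sub_exp ?k_gt0 //.
rewrite big_ord_recr /= big1 => [|i _].
  rewrite add0r subnn dvdn0 binn mulr1 => /esym/eqP.
  rewrite !mulf_eq0 expf_eq0 oppr_eq0 oner_eq0 andbF (negbTE n_neq0) //.
  by move/eqP.
case: ifPn => [n_ki|]; last by rewrite mulr0 mul0r.
rewrite IHk ?mulr0 //; first exact: ltn_trans km.
by apply: contraNN nk => n_i; rewrite -(subnK (ltnW (ltn_ord i))) dvdn_add.
Qed.

(** In the expansion of order [n] only [i = 0] and [i = n] survive, and they must cancel. *)
Lemma power_sum_card : (n < m)%N -> power_sum n = - (-1) ^+ n * #|Y|%:R.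
Proof.
move=> nm; have n_gt0 := ltnW n_gt1.
have := sum_sub_exp_expand n; rewrite sum_sub_exp ?n_gt0 //.
rewrite (bigD1 ord0) //= (bigD1 ord_max) -?val_eqE /= -?lt0n //.
rewrite [X in _ + (_ + X)]big1 => [|i /andP[i_neq0 i_neqn]]; last first.
  rewrite gtnNdvd ?mulr0 ?mul0r //; move: i_neq0 i_neqn (ltn_ord i); rewrite -!val_eqE /=; lia.
rewrite subn0 dvdnn subnn dvdn0 binn bin0 !mulr1 expr0 mul1r addr0 -mulrA mulrCA -mulrDr.
move/esym/eqP; rewrite mulf_eq0 (negbTE n_neq0) //=.
rewrite {1}/power_sum (eq_bigr (fun=> 1)) => [|y _]; last exact: expr0.
rewrite sumr_const => /eqP sum0; apply: (mulfI (negbT (signr_eq0 _ n))).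
rewrite mulrA mulrN -expr2 sqrr_sign mulN1r.
by apply/eqP; rewrite -addr_eq0 addrC sum0.
Qed.
Lemma sum_horner_invariant (q : {poly F}) a : (size q <= m)%N -> a \in A ->
  \sum_(y in Y) q.[a * y] = \sum_(y in Y) q.[y].
Proof.
move=> sz_q aA.
have expand c : \sum_(y in Y) q.[c * y] = \sum_(i < size q) q`_i * c ^+ i * power_sum i.
  rewrite (eq_bigr _ (fun y _ => horner_coef q (c * y))) exchange_big /=.
  apply: eq_bigr => i _; rewrite /power_sum mulr_sumr; apply: eq_bigr => y _.
  by rewrite exprMn mulrA.
rewrite expand -[in RHS](eq_bigr _ (fun y _ => congr1 (horner q) (mul1r y))) expand.
apply: eq_bigr => i _; rewrite expr1n mulr1.
have [/dvdnP[j ->]|n_i] := boolP (n %| i)%N.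
  by rewrite mulnC exprM (subgroup_expr_card A0 AM cardA aA) expr1n mulr1.
by rewrite power_sum_eq0 ?mulr0 // (leq_trans (ltn_ord i)).
Qed.

Lemma card_YIA_le : (#|Y :&: A| <= n)%N.
Proof. by rewrite -cardA subset_leq_card ?subsetIr. Qed.

(* Otherwise a polynomial of degree below [m] vanishing on [Y] and on [a * Y] except at one point
   has different sums over [Y] and over [a * Y]. *)
Lemma Y_invariant a y : a \in A -> y \in Y -> a * y \in Y.
Proof.
move=> aA yY; apply/negPn/negP => nYay.
pose Z := (Y :|: [set a * z | z in Y]) :\ (a * y).
pose q : {poly F} := \prod_(z <- enum Z) ('X - z%:P).
have rootq z : (q.[z] == 0) = (z \in Z) by rewrite -rootE root_prod_XsubC mem_enum.
(* The size is [#|Z| + 1 <= 2 * #|Y|], while [m >= n * (#|Y| - 1)] with [n >= 4] and [#|Y| >= 2]. *)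
have sz_q : (size q <= m)%N.
  rewrite size_prod_XsubC -cardE.
  have yZ : a * y \in Y :|: [set a * z | z in Y] by rewrite inE imset_f ?orbT.
  have := cardsD1 (a * y) (Y :|: [set a * z | z in Y]); rewrite yZ -/Z => cardZ.
  have leU := leq_card_setU Y [set a * z | z in Y].
  have leI := leq_imset_card (fun z => a * z) (mem Y).
  have := card_decomposition; have := card_YIA_le.
  move: (#|Y :&: A|) (#|Z|) cardZ leU leI => t s; rewrite add1n => -> leU leI le_tn def_m.
  have {leU leI}le_s : (s.+1 <= #|Y| + #|Y|)%N by apply: leq_trans leU _; rewrite leq_add2l.
  by move: (#|Y|) le_s def_m Y_gt1 => r; nia.
have := sum_horner_invariant sz_q aA.
rewrite [RHS]big1 => [|z zY]; last first.
  by apply/eqP; rewrite rootq !inE zY andbT; apply: contraNneq nYay => <-.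
rewrite (bigD1 y) //= big1 ?addr0 => [|z /andP[zY ne_zy]]; last first.
  apply/eqP; rewrite rootq !inE imset_f ?orbT ?andbT //.
  by apply: contraNneq ne_zy => /(mulfI (subgroup_neq0 A0 aA)) ->.
by move/eqP; rewrite rootq !inE eqxx.
Qed.

Lemma A_sub_Y a : a \in A -> a \in Y -> A \subset Y.
Proof.
move=> aA aY; apply/subsetP => b; rewrite -{1}(subgroup_mul_imset A0 AM aA).
by case/imsetP=> x xA ->; rewrite mulrC Y_invariant.
Qed.

Lemma YIA_dichotomy : exists2 tau : bool,
  #|Y :&: A| = (tau * n)%N & Y :&: A = if tau then A else set0.
Proof.
have [->|[a]] := set_0Vmem (Y :&: A); first by exists false; rewrite ?cards0.
rewrite inE => /andP[aY aA]; exists true; last exact/setIidPr/(A_sub_Y aA).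
by rewrite mul1n (setIidPr (A_sub_Y aA aY)).
Qed.

(** [tau] tells whether [Y] contains [A], [R] counts [Y :\: A] and [P] is the [n]-th power sum of
    that set. The equation is doubled to match the symmetrized sum. *)
Lemma power_sum_relation : exists tau : bool, exists R : nat, let d := ((-1) ^+ n : F) in
  let P := - (d * (R + tau * n)%:R) - (tau * n)%:R in
  [/\ (n %| R.-1)%N, (0 < R)%N, (n < m)%N, (m = n * (R + tau * n - tau))%N &
   n.+1%:R * ((R%:R *+ 2 - n.+1%:R) * P - R%:R ^+ 2 + R%:R)
     + (tau%:R * n.-1%:R * n.+1%:R * P) *+ 2 = (m.-1%:R * P) *+ 2].
Proof.
have [tau cardI defI] := YIA_dichotomy.
pose Y1 := Y :\: A; pose R := #|Y1|.
have cardY : #|Y| = (R + tau * n)%N by rewrite -cardI addnC cardsID.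
have def_m : (m = n * (R + tau * n - tau))%N.
  by rewrite -card_decomposition cardY cardI mulnBr [(n * tau)%N]mulnC.
have n_m : (n %| m)%N by rewrite def_m dvdn_mulr.
have Y0 : 0 \in Y.
  exact: (stepanov_root0 natF_neq0 A0 A1 AM cardA n_gt1 m_gt1 N_ltp AY card_decomposition).
have Y1_0 : 0 \in Y1 by rewrite inE A0 Y0.
have R_gt0 : (0 < R)%N by apply/card_gt0P; exists 0.
have n_R : (n %| R.-1)%N.
  rewrite /R (cardsD1 0 Y1) Y1_0 add1n /=.
  apply: (dvdn_card_invariant A0 A1 AM cardA); first by rewrite !inE eqxx.
  move=> a z aA; rewrite !inE => /and3P[z_neq0 nAz zY].
  apply/and3P; split; [exact: mulf_neq0 (subgroup_neq0 A0 aA) z_neq0 | | exact: Y_invariant].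
  apply: contra nAz; rewrite -!(subgroup_expr_eq1 A0 A1 AM cardA) exprMn.
  by rewrite (subgroup_expr_card A0 AM cardA aA) mul1r.
have n_lt_m : (n < m)%N.
  have := Y_gt1; rewrite cardY def_m; clear -n_gt3 R_gt0; case: tau; nia.
have sumY1 (h : F -> F) : \sum_(y in Y1) h y = \sum_(y in Y) h y - tau%:R * \sum_(a in A) h a.
  rewrite [\sum_(y in Y) _](big_setID A) /= defI addrC.
  by case: (tau); rewrite ?big_set0 ?mul1r ?mul0r ?subr0 ?addr0 ?addrK // addrK.
have P0 k : (0 < k < n)%N -> \sum_(y in Y1) y ^+ k = 0.
  case/andP=> k_gt0 kn; have n_k : ~~ (n %| k)%N by rewrite gtnNdvd.
  rewrite sumY1 (subgroup_power_sum A0 A1 AM cardA) (negbTE n_k) mulr0 subr0.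
  by apply: power_sum_eq0; rewrite ?(ltn_trans kn).
pose P : F := - ((-1) ^+ n * (R + tau * n)%:R) - (tau * n)%:R.
have Pn : \sum_(y in Y1) y ^+ n = P.
  rewrite sumY1 (subgroup_power_sum A0 A1 AM cardA) dvdnn -/(power_sum n) power_sum_card //.
  by rewrite /P cardY natrM mulNr.
exists tau, R; split=> //.
have local y : y \in Y1 -> n.+1%:R * (y * (y ^+ n - 1) * \sum_(z in Y1 | z != y) (y - z)^-1)
    + tau%:R * n.-1%:R * n.+1%:R * y ^+ n = m.-1%:R * y ^+ n.
  rewrite inE => /andP[yA yY].
  have D_neq0 := subgroup_expr_sub1_neq0 A0 A1 AM cardA yA.
  have := stepanov_log_derivative natF_neq0 A0 A1 AM cardA n_gt1 m_gt1 N_ltp AY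
    card_decomposition yY yA.
  (* Zeros in [A] carry multiplicity [n.-1], and their share is a known partial fraction sum. *)
  have -> : \sum_(z in Y | z != y) (n - (z \in A))%:R / (y - z) =
      n%:R * (\sum_(z in Y1 | z != y) (y - z)^-1)
        + tau%:R * n.-1%:R * (n%:R * y ^+ n.-1 / (y ^+ n - 1)).
    rewrite -(sum_inv_sub_subgroup A0 A1 AM cardA yA) (bigID (mem A)) /= addrC; congr (_ + _).
      rewrite mulr_sumr; apply: eq_big => [z|z /andP[_ /negbTE->]]; last by rewrite subn0.
      by rewrite inE; case: (z \in A); case: (z \in Y); rewrite ?andbT ?andbF.
    rewrite -mulrA mulrCA mulr_sumr mulr_sumr.
    rewrite (eq_bigl (fun z => z \in Y :&: A)) => [|z]; last first.
      rewrite inE; case: eqVneq => [->|]; last by rewrite andbT.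
      by rewrite (negbTE yA) !andbF.
    rewrite defI; case: (tau); last by rewrite big_set0 big1 // => z _; rewrite mul0r mulr0.
    by apply: eq_bigr => a aA; rewrite aA subn1 mul1r.
  move: (\sum_(z in Y1 | _) _) => S E.
  have {2 3}-> : y ^+ n = y * y ^+ n.-1 by rewrite -exprS prednK // ltnW.
  apply: (mulfI n_neq0); transitivity (y * (n%:R * m.-1%:R * y ^+ n.-1)); last by ring.
  by rewrite -E; field.
have dd := sum_divided_difference (ltnW n_gt1) P0.
rewrite -(sum_antisym_inv Y1 (fun y => y * (y ^+ n - 1))) Pn -/R in dd.
rewrite -/P -dd.
set S := \sum_(y in Y1) _.
suff <- : n.+1%:R * S + tau%:R * n.-1%:R * n.+1%:R * P = m.-1%:R * P by ring.
rewrite -Pn /S !mulr_sumr -big_split /=.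
by apply: eq_bigr => y; apply: local.
Qed.

Lemma natF_inj u v : (u < p)%N -> (v < p)%N -> u%:R = v%:R :> F -> u = v.
Proof.
wlog uv : u v / (u <= v)%N => [wlog_uv up vp eq_uv|].
  by case/orP: (leq_total u v) => uv; [|symmetry]; apply: wlog_uv.
move=> up vp eq_uv; apply/eqP; rewrite eqn_leq uv leqNgt; apply/negP => lt_uv.
have : (v - u)%:R != 0 :> F.
  by apply: natF_neq0; rewrite subn_gt0 lt_uv (leq_ltn_trans (leq_subr _ _)).
by rewrite natrB // eq_uv subrr eqxx.
Qed.

(** The relation is refuted for each value of [tau] and each parity of [n]. In three cases it says
    that a product of integers between 1 and [2 * m < p] vanishes in [F]. *)
Lemma no_decomposition : ~~ (m ^ 2 <= p)%N.
Proof.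
apply/negP => m2p; have [tau [R [n_R R_gt0 nm def_m]]] := power_sum_relation.
have [q def_R] : exists q, R = (q * n).+1.
  by case/dvdnP: n_R => q def_R; exists q; rewrite -def_R prednK.
have natm : m.-1%:R = m%:R - 1 :> F by rewrite -subn1 natrB // ltnW.
have natn : n.-1%:R = n%:R - 1 :> F by rewrite -subn1 natrB // ltnW.
rewrite natm natn -natr1.
have nat_neq0 k : (0 < k)%N -> (k <= m.*2)%N -> k%:R != 0 :> F.
  move=> k_gt0 k2m; rewrite natF_neq0 // k_gt0 (leq_trans _ m2p) //.
  by apply: leq_ltn_trans k2m _; rewrite -muln2 expnS expn1 ltn_pmul2l; lia.
rewrite -signr_odd; case: tau def_m => /= def_m; rewrite ?mul0n ?mul1n ?addn0 ?subn0 in def_m *.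
  have {natm}-> : m%:R = n%:R * (R%:R + n%:R - 1) :> F.
    by rewrite def_m natrM natrB ?natrD // addn_gt0 R_gt0.
  have le_m : (R + n <= m)%N by rewrite def_m; clear -n_gt3 R_gt0; nia.
  case: (odd n); rewrite ?expr0 ?expr1 natrD => /eqP; rewrite -subr_eq0 => /eqP E.
    have : R%:R * n.-1%:R * (R + n)%:R != 0 :> F by rewrite !mulf_neq0 // nat_neq0 //; lia.
    rewrite natn natrD => /eqP; apply.
    by rewrite -[RHS]oppr0 -E; ring.
  (* For [tau] true and [n] even the relation does not factor; it reads [u = v] in [F], hence in the
     integers by size. But [R] is 1 modulo [n], so [u] is 3 and [v] is 2 modulo [n > 3]. *)
  pose u := ((n + 3) * R ^ 2 + 3 * n * R)%N; pose v := ((n ^ 2 + 2) * R + 2 * n ^ 3 + 2 * n)%N.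
  have : u = v.
    apply: natF_inj.
    - apply: leq_trans m2p; rewrite /u def_m; exact: quadratic_lt_sqr_l.
    - apply: leq_trans m2p; rewrite /v def_m; exact: quadratic_lt_sqr_r.
    - apply/eqP; rewrite -subr_eq0; apply/eqP.
      rewrite /u /v !natrD !natrM !natrD !natrX.
      by rewrite -[RHS]oppr0 -E; ring.
  have u3 : (u = (q ^ 2 * n ^ 2 + 3 * q ^ 2 * n + 2 * q * n + 6 * q + 1 + 3 * R) * n + 3)%N.
    by rewrite /u def_R; ring.
  have v2 : (v = (n * R + 2 * q + 2 * n ^ 2 + 2) * n + 2)%N.
    by rewrite /v def_R; ring.
  move=> /(congr1 (modn^~ n)); rewrite u3 v2 !modnMDl !modn_small //; lia.
(* Without [A] in [Y], [m = n * R > n] forces [R > 1], and [R] is 1 modulo [n]. *)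
have R_gtn : (n < R)%N.
  by move: nm; rewrite def_m def_R; clear -n_gt3; case: q => [|q]; nia.
have {natm}-> : m%:R = n%:R * R%:R :> F by rewrite def_m natrM.
have le_m : (R + n + 2 <= m)%N by rewrite def_m; clear -n_gt3 R_gtn; nia.
case: (odd n); rewrite ?expr0 ?expr1 => /eqP; rewrite -subr_eq0 => /eqP E.
  have : R%:R * n.-1%:R * (R + n + 2)%:R != 0 :> F by rewrite !mulf_neq0 // nat_neq0 //; lia.
  rewrite natn !natrD => /eqP; apply.
  by rewrite -[RHS]oppr0 -E; ring.
have : R%:R * (n + 3)%:R * (R - n)%:R != 0 :> F by rewrite !mulf_neq0 // nat_neq0 //; lia.
rewrite natrD natrB ?(ltnW R_gtn) // => /eqP; apply.
by rewrite -[RHS]oppr0 -E; ring.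
Qed.
End Decomposition.

(** * Back to sumsets in the prime field *)

Lemma le_pow_half_minus_sqr (m p : nat) (eps : R) : (0 < p)%N -> Rle (IZR 0) eps ->
  le_pow_half_minus m p eps -> (m ^ 2 <= p)%N.
Proof.
move=> p_gt0 eps_ge0 m_le.
have p_ge1 : Rle (IZR 1) (INR p) by apply: (le_INR 1); apply/leP.
have p_pos : Rlt (IZR 0) (INR p) := Rlt_le_trans _ _ _ Rlt_0_1 p_ge1.
have m_sqrt : Rle (INR m) (sqrt (INR p)).
  rewrite -Rpower_sqrt //; apply: Rle_trans m_le _; apply: Rle_Rpower => //.
  by rewrite -{2}(Rminus_0_r (Rinv (IZR 2))); apply: Rplus_le_compat_l; apply: Ropp_le_contravar.
apply/leP/INR_le; rewrite -mulnn mult_INR -[INR p]sqrt_sqrt; last exact: Rlt_le.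
by apply: Rmult_le_compat => //; apply: pos_INR.
Qed.

(** Bounding the sumset between [G] and [0 |: G] treats both target sets at once. *)
Lemma sumset_not_subgroup (p : nat) (A G B : {set 'F_p}) : prime p ->
    mult_subgroup A -> mult_subgroup G -> (3 < #|A|)%N -> (3 < #|G|)%N ->
    (#|G| ^ 2 <= p)%N -> (1 < #|B|)%N ->
  G \subset sumset A B -> sumset A B \subset 0 |: G -> False.
Proof.
move=> p_prime /and3P[A0 A1 AM] /and3P[G0 G1 GM] cA cG cGp cB /subsetP GAB /subsetP ABG.
have closed (S : {set 'F_p}) : [forall x in S, forall y in S, x * y \in S] ->
    {in S &, forall x y, x * y \in S}.
  by move=> /forall_inP SM x y xS yS; move/forall_inP: (SM x xS); apply.
have nat_neq0 k : (0 < k < p)%N -> k%:R != 0 :> 'F_p.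
  by case/andP=> k_gt0 kp; rewrite -(dvdn_pcharf (pchar_Fp p_prime)) gtnNdvd.
have sum_mem a b : a \in A -> b \in B -> a + b \in 0 |: G.
  by move=> aA bB; apply/ABG/imset2P; exists a b.
have [b bB] : exists b, b \in B by apply/card_gt0P; apply: ltnW.
have A_le : (#|A| <= #|G|.+1)%N.
  have -> : #|G|.+1 = #|0 |: G| by rewrite cardsU1 G0.
  rewrite -(card_imset (mem A) (addIr b)); apply/subset_leq_card/subsetP => _ /imsetP[a aA ->].
  exact: sum_mem.
pose Y := [set - x | x in B].
have cY : #|Y| = #|B| := card_imset _ oppr_inj.
suff : ~~ (#|G| ^ 2 <= p)%N by rewrite cGp.
apply: (no_decomposition (A := A) (Y := Y) nat_neq0 A0 A1 (closed _ AM) G0 G1 (closed _ GM)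
  erefl cA erefl).
- exact: leq_trans cG.
(* A translate of [A] lies in [0 |: G], so [n <= m + 1] and [m + n - 1 <= 2 * m < m ^ 2 <= p]. *)
- move: cGp cG A_le; move: #|A| #|G| => n m cGp cG A_le; rewrite expnS expn1 in cGp; nia.
- by rewrite cY.
- move=> a _ aA /imsetP[x xB ->] ne; have := sum_mem a x aA xB.
  by rewrite opprK in_setU1 addr_eq0 (negbTE ne).
- move=> g /GAB/imset2P[a x aA xB ->]; exists a, (- x); split=> //; last by rewrite opprK.
  exact: imset_f.
Qed.

Close Scope ring_scope.

Theorem theorem3 :
  forall eps : R, Rlt (IZR 0) eps /\ Rle eps (IZR 1) ->
  exists C : nat,
  forall p : nat, prime p ->
  forall (A G B : {set 'F_p}),
    mult_subgroup A -> mult_subgroup G ->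
    (C < #|A|)%N -> (C < #|G|)%N ->
    le_pow_half_minus #|G| p eps ->
    B != set0 ->
    (* nontrivial representation: |A| >= 2 and |B| >= 2 *)
    (2 <= #|A|)%N -> (2 <= #|B|)%N ->
    sumset A B != G /\ sumset A B != G :|: [set 0%R].
Proof.
move=> eps [eps_gt0 _]; exists 3 => p p_prime A G B sgA sgG cA cG G_le _ _ cB.
have cGp := le_pow_half_minus_sqr (prime_gt0 p_prime) (Rlt_le _ _ eps_gt0) G_le.
have no_sumset := sumset_not_subgroup p_prime sgA sgG cA cG cGp cB.
split; apply/eqP => def_AB; apply: no_sumset; rewrite def_AB ?subsetU1 ?subsetUl //.
by rewrite setUC.
Qed.
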